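(* Let $G$ be a VPT graph and let $h\geq 3$ be an integer. Then $G\in[h,2,1]$ if and only if the branch graph $B(G/C)$ is $h$-colorable for every clique $C$ of $G$. Moreover, the implication ''$G\in[h,2,1]\Rightarrow B(G/C)$ is $h$-colorable for every clique $C$ of $G$'' also holds for $h=2$.
   Context: All graphs are finite, simple and connected. A clique is a maximal complete set of vertices. An $(h,s,t)$-representation of a graph $G$ is a collection of subtrees $(T_v)_{v\in V(G)}$ of a tree $T$ such that (i) $T$ has maximum degree at most $h$, (ii) every subtree $T_v$ has maximum degree at most $s$, and (iii) two distinct vertices $v,w$ are adjacent in $G$ iff $T_v$ and $T_w$ have at least $t$ vertices in common. $[h,s,t]$ denotes the class of graphs having an $(h,s,t)$-representation; $h=\infty$ or $s=\infty$ means no degree restriction. Thus $[h,2,1]$ is the class of graphs that are vertex-intersection graphs of paths in a tree of maximum degree at most $h$, and VPT $=[\infty,2,1]$. For a clique $C$ of $G$, the branch graph $B(G/C)$ has vertex set the vertices of $V(G)\setminus C$ adjacent to some vertex of $C$, and two such vertices $v,w$ are adjacent in $B(G/C)$ iff (1) $vw\notin E(G)$; (2) some vertex of $C$ is adjacent to both $v$ and $w$; and (3) there exist $v',w'\in C$ with $v'$ adjacent to $v$ but not to $w$, and $w'$ adjacent to $w$ but not to $v$. *)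

(* Defs.v *)
From mathcomp Require Import all_boot.
Set Implicit Arguments. Unset Strict Implicit. Unset Printing Implicit Defensive.

Definition simple_graph (T : finType) (e : rel T) : Prop :=
  symmetric e /\ irreflexive e.

Definition connected_graph (T : finType) (e : rel T) : Prop :=
  (0 < #|T|) /\ (forall x y : T, connect e x y).

Definition acyclic (U : finType) (f : rel U) : Prop :=
  forall (x0 : U) (p : seq U),
    2 <= size p -> uniq (x0 :: p) -> path f x0 p -> ~~ f (last x0 p) x0.

Definition is_tree (U : finType) (f : rel U) : Prop :=
  simple_graph f /\ connected_graph f /\ acyclic f.

Definition restr (U : finType) (f : rel U) (S : {set U}) : rel U :=
  [rel x y | [&& f x y, x \in S & y \in S]].

Definition subtree (U : finType) (f : rel U) (S : {set U}) : Prop :=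
  S != set0 /\ (forall x y, x \in S -> y \in S -> connect (restr f S) x y).

(* Degree bound; None stands for infinity (no restriction). *)
Definition deg_le (U : finType) (f : rel U) (S : {set U}) (b : option nat) : Prop :=
  match b with
  | None => True
  | Some k => forall x, x \in S -> #|[set y in S | f x y]| <= k
  end.

Definition hst_rep (T : finType) (e : rel T) (h s : option nat) (t : nat)
    (U : finType) (f : rel U) (Tv : T -> {set U}) : Prop :=
  [/\ is_tree f,
      deg_le f setT h,
      (forall v, subtree f (Tv v)),
      (forall v, deg_le f (Tv v) s) &
      (forall v w, v != w -> (e v w <-> t <= #|Tv v :&: Tv w|))].

Definition in_hst (T : finType) (e : rel T) (h s : option nat) (t : nat) : Prop :=
  exists (U : finType) (f : rel U) (Tv : T -> {set U}), hst_rep e h s t f Tv.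

Definition VPT (T : finType) (e : rel T) : Prop := in_hst e None (Some 2) 1.

Definition is_clique (T : finType) (e : rel T) (C : {set T}) : Prop :=
  (forall x y, x \in C -> y \in C -> x != y -> e x y) /\
  (forall z, z \notin C -> exists2 x, x \in C & ~~ e z x).

Definition branch_vertices (T : finType) (e : rel T) (C : {set T}) : {set T} :=
  [set v | (v \notin C) && [exists c in C, e v c]].

Definition branch_edge (T : finType) (e : rel T) (C : {set T}) (v w : T) : Prop :=
  [/\ v \in branch_vertices e C, w \in branch_vertices e C,
      ~~ e v w,
      (exists2 c, c \in C & e c v && e c w) &
      ((exists2 v', v' \in C & e v' v && ~~ e v' w) /\
       (exists2 w', w' \in C & e w' w && ~~ e w' v))].

Definition branch_colorable (T : finType) (e : rel T) (C : {set T}) (h : nat) : Prop :=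
  exists col : T -> 'I_h,
    forall v w, branch_edge e C v w -> col v != col w.

(* Main.v *)
(** Call the set of paths through a host vertex q the bag of q. A clique C is a
    bag by the Helly property; root the host tree at its vertex q. A path that
    avoids q lives in a single branch at q, and two such paths in the same
    branch are never adjacent in B(G/C), so the neighbours of q colour B(G/C).

    Conversely, contract host edges qq' such that the bag of q is contained in
    that of q'; then every nonempty bag becomes a clique. Link two neighbours
    of q when some path runs through q and both of them. This graph is
    h-colourable: every neighbour of q lying on a path through q also lies on a
    path that avoids q, and for linked neighbours with at least two links each
    these paths are adjacent in B(G/C), where C is the bag of q; the other
    neighbours of q are coloured last. While q has more than h neighbours, two
    of them, i and j, share a colour, hence no path through q: detach both from
    q and hang them from a new neighbour of q, of degree 3 <= h. This lowers
    the degree of q and keeps the links colourable. *)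
Require Import Defs.
From mathcomp Require Import all_boot.
Set Implicit Arguments.
Unset Strict Implicit.
Unset Printing Implicit Defensive.

(** * Colourings *)

Definition colorable (T : finType) (E : rel T) (h : nat) : Prop :=
  exists col : T -> 'I_h, forall x y, E x y -> col x != col y.

Lemma exists_inj_ord (T : finType) (A : {set T}) n :
  #|A| <= n.+1 -> exists col : T -> 'I_n.+1, {in A &, injective col}.
Proof.
move=> leA; exists (fun x => inord (index x (enum A))) => x y xA yA.
have index_lt z : z \in A -> index z (enum A) < n.+1.
  by move=> zA; apply: leq_trans leA; rewrite cardE index_mem mem_enum.
move=> /(congr1 val) /=; rewrite !inordK ?index_lt // => eq_index.
by apply: (index_inj x _ _ eq_index); rewrite mem_enum.
Qed.

Lemma colorable_hom (T T' : finType) (E : rel T) (E' : rel T') (g : T -> T') h :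
  (forall x y, E x y -> E' (g x) (g y)) -> colorable E' h -> colorable E h.
Proof. by move=> hom [col colP]; exists (col \o g) => x y /hom /colP. Qed.

(* A vertex of degree at most 1 can be coloured after all the others. *)
Lemma colorable_deg_gt1 (T : finType) (E : rel T) h (c : T -> 'I_h.+2) :
  symmetric E -> irreflexive E ->
  (forall x y, E x y -> 1 < #|E x| -> 1 < #|E y| -> c x != c y) ->
  colorable E h.+2.
Proof.
move=> symE irrE cP.
pose other (a : 'I_h.+2) : 'I_h.+2 :=
  if a == ord0 then lift ord0 ord0 else ord0.
have otherP a : other a != a.
  by rewrite /other; have [->|] := eqVneq a ord0; rewrite // eq_sym.
pose nbr x := odflt x [pick y | E x y].
have nbrP x y : ~~ (1 < #|E x|) -> E x y -> nbr x = y.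
  rewrite -leqNgt => /card_le1_eqP eqE xy; rewrite /nbr.
  by case: pickP => [z xz|/(_ y)] /=; [apply: eqE | rewrite xy].
pose col x := if 1 < #|E x| then c x else
  if 1 < #|E (nbr x)| then other (c (nbr x)) else
  if enum_rank x < enum_rank (nbr x) then ord0 else other ord0.
exists col => x y.
wlog degx : x y / ~~ (1 < #|E x|) => [wlog_deg xy|xy].
  have [degx|/wlog_deg] := boolP (1 < #|E x|); last exact.
  have [degy|/wlog_deg] := boolP (1 < #|E y|).
    by rewrite /col degx degy cP.
  by rewrite eq_sym; apply; rewrite symE.
rewrite /col (nbrP x y) // (negPf degx).
have [degy|degy] := boolP (1 < #|E y|); first exact: otherP.
rewrite (nbrP y x) -1?symE // (negPf degx).
have : enum_rank x != enum_rank y.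
  by rewrite (inj_eq enum_rank_inj); apply: contraTneq xy => ->; rewrite irrE.
by rewrite neq_ltn => /orP [] lt_rank; rewrite lt_rank ltnNge (ltnW lt_rank).
Qed.

(** * Rooted trees *)

Definition nbrs (U : finType) (f : rel U) (S : {set U}) (x : U) : {set U} :=
  [set y in S | f x y].

Lemma restr_sym (U : finType) (f : rel U) (S : {set U}) :
  symmetric f -> symmetric (restr f S).
Proof. by move=> symf x y; rewrite /restr /= symf (andbC (x \in S)). Qed.

Lemma connect_restrS (U : finType) (f : rel U) (S S' : {set U}) :
  S \subset S' -> subrel (connect (restr f S)) (connect (restr f S')).
Proof.
move=> /subsetP sub; apply: connect_sub => x y /and3P [fxy xS yS].
by apply: connect1; rewrite /restr /= fxy !sub.
Qed.

Lemma subtreeU (U : finType) (f : rel U) (S S' : {set U}) x :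
  subtree f S -> subtree f S' -> x \in S -> x \in S' -> subtree f (S :|: S').
Proof.
move=> [_ connS] [_ connS'] xS xS'.
split; first by apply/set0Pn; exists x; rewrite inE xS.
have connU := @connect_restrS _ f _ _ (subsetUl S S').
have connU' := @connect_restrS _ f _ _ (subsetUr S S').
have to_x y : y \in S :|: S' -> connect (restr f (S :|: S')) y x.
  by case/setUP=> [yS|yS']; [apply/connU/connS | apply/connU'/connS'].
have from_x y : y \in S :|: S' -> connect (restr f (S :|: S')) x y.
  by case/setUP=> [yS|yS']; [apply/connU/connS | apply/connU'/connS'].
by move=> y z /to_x yx /from_x; apply: connect_trans.
Qed.

Definition parent_rel (U : eqType) (r : U) (par : U -> U) : rel U :=
  fun x y => (x != r) && (par x == y).

Definition parent_adj (U : eqType) (r : U) (par : U -> U) : rel U :=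
  fun x y => parent_rel r par x y || parent_rel r par y x.

(* [par r] is irrelevant: the root has no parent. *)
Definition rooted (U : finType) (f : rel U) (r : U) (par : U -> U)
    (depth : U -> nat) : Prop :=
  f =2 parent_adj r par /\ (forall x, x != r -> depth (par x) < depth x).

Definition below (U : finType) (r : U) (par : U -> U) : rel U :=
  connect (parent_rel r par).

Section RootedTree.
Variables (U : finType) (f : rel U) (r : U) (par : U -> U) (depth : U -> nat).
Hypothesis rf : rooted f r par depth.
Local Notation parent := (parent_rel r par).
Local Notation below := (below r par).

Lemma rooted_adj x y : f x y = parent x y || parent y x.
Proof. by rewrite rf.1. Qed.

Lemma depth_par x : x != r -> depth (par x) < depth x.
Proof. exact: rf.2. Qed.

Lemma rooted_sym : symmetric f.
Proof. by move=> x y; rewrite !rooted_adj orbC. Qed.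

Lemma rooted_irr : irreflexive f.
Proof.
move=> x; rewrite rooted_adj orbb; apply/negP=> /andP [/depth_par + /eqP parx].
by rewrite parx ltnn.
Qed.

Lemma parent_par x : x != r -> parent x (par x).
Proof. by move=> xr; rewrite /parent_rel xr eqxx. Qed.

Lemma adj_par x : x != r -> f x (par x).
Proof. by move=> xr; rewrite rooted_adj parent_par. Qed.

Lemma adj_root x : f r x = (x != r) && (par x == r).
Proof. by rewrite rooted_adj /parent_rel eqxx. Qed.

Lemma below_depth x y : below x y -> depth y <= depth x.
Proof.
case/connectP=> p; elim: p x => [|z p IH] x /=; first by move=> _ ->.
case/andP=> /andP [/depth_par ltx /eqP <-] pp /(IH _ pp) ley.
exact: leq_trans ley (ltnW ltx).
Qed.

Lemma below_par x y : below x y -> x != y -> (x != r) && below (par x) y.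
Proof.
case/connectP=> [[|z p]] /=; first by move=> _ ->; rewrite eqxx.
by case/andP=> /andP [-> /eqP ->] pz -> _; apply/connectP; exists p.
Qed.

Lemma below_depth_lt x y : below x y -> x != y -> depth y < depth x.
Proof.
move=> xy /(below_par xy) /andP [/depth_par ltx /below_depth ley].
exact: leq_ltn_trans ley ltx.
Qed.

Lemma below_refl x : below x x.
Proof. exact: connect0. Qed.

Lemma below_trans : transitive below.
Proof. exact: connect_trans. Qed.

Lemma below_anti x y : below x y -> below y x -> x = y.
Proof.
move=> xy yx; apply: contraTeq (below_depth yx) => ne.
by rewrite -ltnNge below_depth_lt.
Qed.

Lemma below_root x : below x r.
Proof.
have [n] := ubnP (depth x); elim: n x => // n IH x lt_n.
have [->|xr] := eqVneq x r; first exact: below_refl.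
apply: below_trans (connect1 (parent_par xr)) (IH _ _).
exact: leq_trans (depth_par xr) lt_n.
Qed.

Lemma below_child x y : below x y -> x != y ->
  exists2 z, below x z & parent z y.
Proof.
case/connectP=> p; case/lastP: p => [|p z] /=.
  by move=> _ ->; rewrite eqxx.
rewrite rcons_path last_rcons => /andP [px uz] -> _.
by exists (last x p) => //; apply/connectP; exists p.
Qed.

Lemma below_total x y z : below x y -> below x z -> below y z || below z y.
Proof.
case/connectP=> p; elim: p x => [|x' p IH] x /=; first by move=> _ -> ->.
case/andP=> /andP [xr /eqP <-] pp py xz.
have [<-|nxz] := eqVneq x z.
  apply/orP; right; apply: below_trans (connect1 (parent_par xr)) _.
  by apply/connectP; exists p.
by have /andP [_ pxz] := below_par xz nxz; apply: IH pp py pxz.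
Qed.

Lemma below_children_eq x y z :
  f r y -> f r z -> below x y -> below x z -> y = z.
Proof.
have child_below a b : f r a -> f r b -> below a b -> a = b.
  rewrite !adj_root => /andP [_ /eqP para] /andP [br _] ab.
  apply: contraNeq br => /(below_par ab); rewrite para => /andP [_ rb].
  by rewrite (below_anti rb (below_root b)).
move=> fy fz xy xz; case/orP: (below_total xy xz) => [yz|zy].
  exact: child_below.
by apply/esym/child_below.
Qed.

Lemma rooted_acyclic : acyclic f.
Proof.
move=> x0 p p2 uniq_p path_p; apply/negP=> last_x0.
(* Both neighbours on the cycle of a deepest vertex would be its parent. *)
have cyc : cycle f (x0 :: p) by rewrite /= rcons_path path_p.
case: (arg_maxnP depth (mem_head x0 p)) => m mp mmax.
have [i s rot_i] := rot_to mp.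
have : cycle f (m :: s) by rewrite -rot_i rot_cycle.
have : uniq (m :: s) by rewrite -rot_i rot_uniq.
have : 2 <= size s.
  by rewrite -ltnS -[(size s).+1]/(size (m :: s)) -rot_i size_rot.
have par_eq w : w \in m :: s -> f m w -> par m = w.
  rewrite -rot_i mem_rot => /mmax /= max_w; rewrite rooted_adj.
  case/orP=> [/andP [_ /eqP //]|/andP [/depth_par + /eqP parw]].
  by rewrite parw ltnNge max_w.
case: s par_eq {rot_i} => [|y [|z s]] //= par_eq _ uniq_s.
rewrite rcons_path => /and4P [fmy _ _ flm].
have par_y : par m = y by apply: par_eq; rewrite // !inE eqxx orbT.
have par_last : par m = last z s.
  by apply: par_eq; rewrite 1?rooted_sym // inE in_cons mem_last !orbT.
by case/and3P: uniq_s => _; rewrite -par_y par_last mem_last.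
Qed.

Lemma rooted_tree : is_tree f.
Proof.
split; first by split; [exact: rooted_sym | exact: rooted_irr].
split; last exact: rooted_acyclic.
split; first by apply/card_gt0P; exists r.
have to_root x : connect f x r.
  apply: connect_sub (below_root x) => a b ab.
  by rewrite connect1 // rooted_adj ab.
move=> x y; apply: connect_trans (to_root x) _.
by rewrite (sym_connect_sym rooted_sym).
Qed.

Lemma subtree_of_top (S : {set U}) t :
  t \in S -> (forall x, x \in S -> x != t -> (x != r) && (par x \in S)) ->
  subtree f S.
Proof.
move=> tS topt; split; first by apply/set0Pn; exists t.
have symS := sym_connect_sym (restr_sym S rooted_sym).
suff to_top x : x \in S -> connect (restr f S) x t.
  by move=> x y /to_top xt /to_top; rewrite symS; apply: connect_trans.
have [n] := ubnP (depth x); elim: n x => // n IH x lt_n xS.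
have [->|xt] := eqVneq x t; first exact: connect0.
have /andP [xr parS] := topt x xS xt.
apply: connect_trans (IH _ (leq_trans (depth_par xr) lt_n) parS).
by apply: connect1; rewrite /restr /= adj_par // xS.
Qed.

(* The top is a vertex of least depth: everything in [S] stays below it, since
   leaving the part below [t] means stepping from [t] to its parent. *)
Lemma subtree_top S : subtree f S -> exists t, [/\ t \in S,
  forall x, x \in S -> below x t &
  forall x, x \in S -> x != t -> (x != r) && (par x \in S)].
Proof.
case=> /set0Pn [s sS] connS; case: (arg_minnP depth sS) => t tS tmin.
have connect_below x y : x \in S -> y \in S ->
    ((x != r) && (par x \in S)) || below y x.
  move=> xS yS; apply/norP=> -[npar /negP []].
  suff : y \in [pred z | (z \in S) && below z x] by case/andP.
  have symS := sym_connect_sym (restr_sym S rooted_sym).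
  have <- := closed_connect (intro_closed symS _) (connS x y xS yS).
    by rewrite inE xS below_refl.
  move=> a b /and3P [fab _ bS]; rewrite !inE bS => /andP [aS ax] /=.
  move: fab; rewrite rooted_adj => /orP [|ba];
    last exact: below_trans (connect1 ba) ax.
  case/andP=> ar /eqP parb; have [eq_ax|nax] := eqVneq a x.
    by move: npar; rewrite -eq_ax ar parb bS.
  by have := below_par ax nax; rewrite parb => /andP [].
have topt x : x \in S -> below x t.
  move=> xS; have := connect_below t x tS xS; case: andP => //= -[tr parS] _.
  by have := tmin _ parS; rewrite leqNgt depth_par.
exists t; split=> // x xS xt; have := connect_below x t xS tS.
by case/orP=> // tx; move: xt; rewrite (below_anti tx (topt x xS)) eqxx.
Qed.

Lemma subtree_convex S x y t :
  subtree f S -> x \in S -> t \in S -> below x y -> below y t -> y \in S.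
Proof.
case/subtree_top=> top [_ below_top par_top] + /below_top ttop + yt.
have ytop := below_trans yt ttop.
move=> + /connectP [p]; elim: p x => [|z p IH] x /= xS; first by move=> _ ->.
case/andP=> /andP [xr /eqP <-] pp lasty.
have [xtop|/(par_top x xS)] := eqVneq x top.
  have xy : below x y.
    apply: below_trans (connect1 (parent_par xr)) _.
    by apply/connectP; exists p.
  by rewrite -xtop in ytop; rewrite -(below_anti xy ytop).
by case/andP=> _ parS; apply: IH parS pp lasty.
Qed.

Lemma subtree_below S x y :
  subtree f S -> r \in S -> x \in S -> below x y -> y \in S.
Proof. by move=> sS rS xS xy; apply: subtree_convex xy (below_root y). Qed.

Lemma subtree_par S x :
  subtree f S -> r \in S -> x \in S -> x != r -> par x \in S.
Proof. by move=> sS rS xS /parent_par /connect1; apply: subtree_below. Qed.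

Lemma subtree_below_child S y :
  subtree f S -> r \notin S -> f r y -> y \in S ->
  forall x, x \in S -> below x y.
Proof.
move=> /subtree_top [t [_ topt part]] rS.
rewrite adj_root => /andP [_ /eqP pary] yS.
have [-> //|/(part y yS)] := eqVneq y t.
by rewrite pary (negPf rS) andbF.
Qed.

Lemma subtree_in_branch S : subtree f S -> r \notin S ->
  exists2 y, f r y & forall x, x \in S -> below x y.
Proof.
move=> /subtree_top [t [tS topt _]] rS.
have tr : t != r by apply: contraNneq rS => <-.
have [y ty yr] := below_child (below_root t) tr.
exists y => [|x /topt xt]; first by rewrite rooted_adj yr orbT.
exact: below_trans xt ty.
Qed.

(* Among the tops of the subtrees, a deepest one lies in all of them. *)
Lemma rooted_helly (I : finType) (F : I -> {set U}) (A : {set I}) :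
  A != set0 -> (forall i, subtree f (F i)) ->
  (forall i j, i \in A -> j \in A -> i != j -> F i :&: F j != set0) ->
  exists q, forall i, i \in A -> q \in F i.
Proof.
move=> /set0Pn [i0 i0A] sF meet.
have [top topP] := fin_all_exists (fun i => subtree_top (sF i)).
case: (arg_maxnP (depth \o top) i0A) => /= i iA max_i.
exists (top i) => j jA.
have [ti belowi _] := topP i; have [tj belowj _] := topP j.
have [-> //|nji] := eqVneq j i.
have /set0Pn [x /setIP [xj xi]] := meet j i jA iA nji.
apply: (subtree_convex (sF j) xj tj (belowi x xi)).
case/orP: (below_total (belowi x xi) (belowj x xj)) => // ji.
have [<-|ne] := eqVneq (top j) (top i); first exact: below_refl.
by have := below_depth_lt ji ne; rewrite ltnNge; have /= -> := max_i j jA.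
Qed.

End RootedTree.

Lemma connected_parent (U : finType) (f : rel U) (r : U) :
  (forall x, connect f x r) ->
  exists par depth, forall x, x != r -> f x (par x) /\ depth (par x) < depth x.
Proof.
move=> conn_r.
pose walk x n := [exists t : n.-tuple U, path f x t && (last x t == r)].
have [x|depth depthP] := @fin_all_exists U (fun=> nat)
    (fun x n => walk x n /\ forall m, walk x m -> n <= m).
  have exists_walk : exists n, walk x n.
    have /connectP [p px last_p] := conn_r x.
    exists (size p); apply/existsP; exists (in_tuple p).
    by rewrite /= px -last_p eqxx.
  by case: (ex_minnP exists_walk) => n walk_n min_n; exists n.
have [x|par parP] := @fin_all_exists U (fun=> U)
    (fun x y => x != r -> f x y /\ depth y < depth x); last first.
  by exists par, depth.
have [xr|xr] := eqVneq x r; first by exists x.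
have [/existsP [[[|y p] /= /eqP size_p]] + _] := depthP x.
  by rewrite (negPf xr).
case/andP=> /andP [fxy path_p] last_p; exists y => _; split=> //.
rewrite -size_p ltnS; apply: (depthP y).2; apply/existsP.
by exists (in_tuple p); rewrite /= path_p.
Qed.

Definition del_edge (U : eqType) (f : rel U) (x y : U) : rel U :=
  fun a b => [&& f a b, ~~ ((a == x) && (b == y)) & ~~ ((a == y) && (b == x))].

Lemma del_edge_sym (U : eqType) (f : rel U) x y :
  symmetric f -> symmetric (del_edge f x y).
Proof.
move=> symf a b; rewrite /del_edge symf; congr (_ && _).
by rewrite andbC (andbC (a == y)) (andbC (a == x)).
Qed.

Lemma acyclic_bridge (U : finType) (f : rel U) x y :
  simple_graph f -> acyclic f -> f x y -> ~~ connect (del_edge f x y) x y.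
Proof.
move=> [symf irrf] acyc fxy; apply/negP=> /connectP [p0 path_p0 last_p].
case: (shortenP path_p0) last_p => p path_p uniq_p _ last_p.
have fpath : path f x p by apply: sub_path path_p => a b /andP [].
have := acyc x p; rewrite -last_p symf fxy => /(_ _ uniq_p fpath) short_p.
suff : 1 < size p by move/short_p.
case: p path_p {uniq_p fpath short_p} last_p => [|a [|b p]] //= path_p last_p.
  by rewrite last_p irrf in fxy.
by move: path_p; rewrite -last_p /del_edge !eqxx !andbF.
Qed.

Lemma tree_rooted (U : finType) (f : rel U) (r : U) :
  is_tree f -> exists par depth, rooted f r par depth.
Proof.
move=> [[symf irrf] [[_ conn] acyc]].
have [par [depth parP]] := connected_parent (fun x => conn x r).
exists par, depth; split=> [x y|x /parP [] //].
apply/idP/idP=> [fxy|]; last first.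
  by case/orP=> /andP [/parP [fpar _] /eqP <-]; rewrite // symf.
(* Otherwise climbing to the root from both ends avoids the edge, which is then
   no bridge. *)
apply: contraTT (acyclic_bridge (conj symf irrf) acyc fxy) => /norP [nxy nyx].
rewrite negbK; have sym_del := sym_connect_sym (del_edge_sym x y symf).
suff to_root z : connect (del_edge f x y) z r.
  by apply: connect_trans (to_root x) _; rewrite sym_del.
have [n] := ubnP (depth z); elim: n z => // n IH z lt_n.
have [->|zr] := eqVneq z r; first exact: connect0.
have [fz lt_par] := parP z zr.
apply: connect_trans (IH _ (leq_trans lt_par lt_n)); apply: connect1.
rewrite /del_edge fz /=; apply/andP; split.
  apply: contraNN nxy => /andP [/eqP <- /eqP <-].
  exact: parent_par.
apply: contraNN nyx => /andP [/eqP <- /eqP <-].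
exact: parent_par.
Qed.

Lemma tree_helly (U : finType) (f : rel U) (I : finType) (F : I -> {set U})
    (A : {set I}) :
  is_tree f -> A != set0 -> (forall i, subtree f (F i)) ->
  (forall i j, i \in A -> j \in A -> i != j -> F i :&: F j != set0) ->
  exists q, forall i, i \in A -> q \in F i.
Proof.
move=> treef A0 sF meet; have [_ [[/card_gt0P [r _] _] _]] := treef.
have [par [depth rf]] := tree_rooted r treef.
exact: (rooted_helly rf A0 sF meet).
Qed.

Lemma deg2_nbr_eq (U : finType) (f : rel U) S q x y z :
  deg_le f S (Some 2) -> q \in S -> x \in S -> y \in S -> z \in S ->
  f q x -> f q y -> f q z -> x != y -> x != z -> y = z.
Proof.
move=> degS qS xS yS zS fx fy fz xy xz; apply/eqP; have := degS q qS.
rewrite (cardsD1 x) inE xS fx add1n ltnS => /card_le1_eqP eqS.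
by apply/eqP/eqS; rewrite !inE eq_sym ?xy ?xz ?yS ?zS.
Qed.

Lemma path_below_total (U : finType) (f : rel U) r par depth S y a b :
  rooted f r par depth -> subtree f S -> deg_le f S (Some 2) -> r \in S ->
  f r y -> a \in S -> b \in S -> below r par a y -> below r par b y ->
  below r par a b || below r par b a.
Proof.
move=> rf sS degS rS fy aS bS a_below b_below.
have y_above : below r par a y && below r par b y by rewrite a_below.
pose above := [pred m | below r par a m && below r par b m].
case: (@arg_maxnP _ _ above depth y_above) => m /= /andP [am bm] deepest.
have [->|nam] := eqVneq a m; first by rewrite bm orbT.
have [->|nbm] := eqVneq b m; first by rewrite am.
have mS := subtree_below rf sS rS aS am.
have mr : m != r.
  apply: contraTneq (deepest y y_above) => ->; move: fy; rewrite (adj_root rf).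
  by case/andP=> /(depth_par rf) + /eqP pary; rewrite pary -ltnNge.
have child c : c \in S -> below r par c m -> c != m ->
    exists c', [/\ c' \in S, below r par c c', f m c', depth m < depth c' &
      par m != c'].
  move=> cS cm /(below_child cm) [c' cc' /andP [c'r /eqP parc']].
  have := depth_par rf c'r; rewrite parc' => lt_c'; exists c'; split=> //.
  - exact: (subtree_below rf sS rS cS).
  - by rewrite (rooted_sym rf) -parc' (adj_par rf).
  - have := ltn_trans (depth_par rf mr) lt_c'.
    by apply: contraTneq => ->; rewrite ltnn.
have [a' [a'S aa' fa' lta' npa']] := child a aS am nam.
have [b' [b'S bb' fb' _ npb']] := child b bS bm nbm.
have parS := subtree_par rf sS rS mS mr.
have eq_children : a' = b'.
  exact: (deg2_nbr_eq degS mS parS a'S b'S (adj_par rf mr)).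
have above_a' : above a' by rewrite /= aa' eq_children bb'.
by have := deepest a' above_a'; rewrite /= leqNgt lta'.
Qed.

(** * Representations *)

Section Bags.
Variables (T U : finType).
Implicit Types (f : rel U) (Tv : T -> {set U}) (q y z : U).

Definition bag Tv q : {set T} := [set v | q \in Tv v].

Definition link f Tv q : rel U := fun y z =>
  [&& f q y, f q z, y != z &
      [exists v, [&& q \in Tv v, y \in Tv v & z \in Tv v]]].

Lemma link_sym f Tv q : symmetric (link f Tv q).
Proof.
move=> y z; rewrite /link eq_sym andbCA; do 3!congr andb.
by apply: eq_existsb => v; rewrite (andbC (y \in Tv v)).
Qed.

Lemma link_irr f Tv q : irreflexive (link f Tv q).
Proof. by move=> y; rewrite /link eqxx !andbF. Qed.

Definition locally_colorable f Tv (h : nat) : Prop :=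
  forall q, colorable (link f Tv q) h.

Definition reduced f Tv : Prop :=
  forall q q', f q q' -> bag Tv q != set0 -> ~~ (bag Tv q \subset bag Tv q').

End Bags.

Section Representation.
Variables (T U : finType) (e : rel T) (f : rel U) (Tv : T -> {set U}).
Variables (deg_bound : option nat).
Hypotheses (se : simple_graph e) (rep : hst_rep e deg_bound (Some 2) 1 f Tv).

Lemma rep_tree : is_tree f.
Proof. by case: rep. Qed.

Lemma rep_subtree v : subtree f (Tv v).
Proof. by case: rep. Qed.

Lemma rep_deg v : deg_le f (Tv v) (Some 2).
Proof. by case: rep. Qed.

Lemma rep_adjP v w :
  v != w -> reflect (exists2 x, x \in Tv v & x \in Tv w) (e v w).
Proof.
case: rep => _ _ _ _ adj /adj vw.
apply: (iffP idP) => [/vw /card_gt0P [x]|[x xv xw]].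
  by rewrite inE => /andP [xv xw]; exists x.
by apply/vw/card_gt0P; exists x; rewrite inE xv.
Qed.

Lemma complete_sub_bag (D : {set T}) : D != set0 ->
  (forall x y, x \in D -> y \in D -> x != y -> e x y) ->
  exists q, D \subset bag Tv q.
Proof.
move=> D0 complD.
have [x y xD yD xy|q qD] := tree_helly rep_tree D0 rep_subtree.
  have /(rep_adjP xy) [p px py] := complD x y xD yD xy.
  by apply/set0Pn; exists p; rewrite inE px.
by exists q; apply/subsetP=> x /qD; rewrite inE.
Qed.

Lemma clique_bag C : C != set0 -> is_clique e C -> exists q, C = bag Tv q.
Proof.
move=> C0 [complC maxC]; have [q sub_q] := complete_sub_bag C0 complC.
exists q; apply/eqP; rewrite eqEsubset sub_q.
apply/subsetP=> x; rewrite inE => qx; apply/negPn/negP=> xC.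
have [c cC /negP []] := maxC x xC.
have xc : x != c by apply: contraNneq xC => ->.
by apply/(rep_adjP xc); exists q => //; have := subsetP sub_q c cC; rewrite inE.
Qed.

Lemma reduced_bag_clique q :
  reduced f Tv -> bag Tv q != set0 -> is_clique e (bag Tv q).
Proof.
move=> red q0.
have compl_q x y : x \in bag Tv q -> y \in bag Tv q -> x != y -> e x y.
  by rewrite !inE => qx qy xy; apply/(rep_adjP xy); exists q.
split=> // z zq.
have [/exists_inP [x xq nezx]|nex] := boolP [exists x in bag Tv q, ~~ e z x].
  by exists x.
have ez x : x \in bag Tv q -> e z x.
  by move=> xq; apply: contraNT nex => nezx; apply/exists_inP; exists x.
have [||r] := @complete_sub_bag (z |: bag Tv q).
- by apply/set0Pn; exists z; rewrite setU11.
- move=> x y /setU1P [->|xq] /setU1P [->|yq] xy.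
  + by rewrite eqxx in xy.
  + exact: ez.
  + by rewrite se.1 ez.
  + exact: compl_q.
rewrite subUset sub1set => /andP [zr sub_r].
have [par [depth rf]] := tree_rooted r rep_tree.
have qr : q != r by apply: contraNneq zq => ->.
case/negP: (red q (par q) (adj_par rf qr) q0); apply/subsetP=> v vq.
have := subsetP sub_r v vq; move: vq; rewrite !inE => qv rv.
exact: (subtree_par rf (rep_subtree v)).
Qed.

Lemma bag_adj q v w : v \in bag Tv q -> w \notin bag Tv q ->
  reflect (exists2 x, x \in Tv v & x \in Tv w) (e v w).
Proof. by move=> vq wq; apply: rep_adjP; apply: contraNneq wq => <-. Qed.

(* [Tv z :|: Tv w] contains the whole path from [x'] to the root, hence [x]. *)
Lemma bag_adj_above q par depth v w x x' z :
  rooted f q par depth -> v \notin bag Tv q -> w \notin bag Tv q ->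
  v != w -> ~~ e v w -> x \in Tv v -> x' \in Tv w -> below q par x' x ->
  z \in bag Tv q -> e z w -> e z v.
Proof.
move=> rf vq wq nvw nevw xv x'w x'x zq /(bag_adj zq wq) [t tz tw].
apply/(bag_adj zq vq); exists x => //.
have sUzw := subtreeU (rep_subtree z) (rep_subtree w) tz tw.
have : x \in Tv z :|: Tv w.
  move: zq; rewrite inE => qz.
  by apply: (subtree_below rf sUzw _ _ x'x); rewrite inE ?qz ?x'w ?orbT.
by case/setUP=> // xw; case/negP: nevw; apply/(rep_adjP nvw); exists x.
Qed.

Lemma branch_edge_diff_branch q par depth y v w :
  rooted f q par depth -> f q y -> branch_edge e (bag Tv q) v w ->
  (forall x, x \in Tv v -> below q par x y) ->
  ~ (forall x, x \in Tv w -> below q par x y).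
Proof.
move=> rf fy [vB wB nevw [u uq /andP [euv euw]] [[v' v'q /andP [ev'v nev'w]]]].
move=> [w' w'q /andP [ew'w new'v]] vy wy.
have /setIdP [vq _] := vB; have /setIdP [wq _] := wB.
have nvw : v != w by apply: contraTneq ev'v => ->.
have /(bag_adj uq vq) [x xu xv] := euv.
have /(bag_adj uq wq) [x' x'u x'w] := euw.
have qu : q \in Tv u by move: uq; rewrite inE.
have := path_below_total rf (rep_subtree u) (@rep_deg u) qu fy xu x'u.
case/(_ (vy x xv) (wy x' x'w))/orP=> [xx'|x'x].
  case/negP: nev'w; apply: (bag_adj_above rf wq vq _ _ x'w xv xx' v'q ev'v).
    by rewrite eq_sym.
  by rewrite se.1.
case/negP: new'v.
exact: (bag_adj_above rf vq wq nvw nevw xv x'w x'x w'q ew'w).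
Qed.

Lemma bag_branch_colorable q h :
  #|nbrs f setT q| <= h.+1 -> branch_colorable e (bag Tv q) h.+1.
Proof.
move=> degq; have [par [depth rf]] := tree_rooted q rep_tree.
have [v|br brP] := @fin_all_exists T (fun=> U) (fun v y => v \notin bag Tv q ->
    f q y /\ forall x, x \in Tv v -> below q par x y).
  have [vq|] := boolP (v \in bag Tv q); first by exists q.
  rewrite inE => qv.
  have [y fy below_y] := subtree_in_branch rf (rep_subtree v) qv.
  by exists y.
have [col col_inj] := exists_inj_ord degq.
exists (col \o br) => v w edge_vw.
have [/setIdP [vq _] /setIdP [wq _] _ _ _] := edge_vw.
have [fv below_v] := brP v vq; have [fw below_w] := brP w wq.
apply/eqP=> /col_inj eq_br.
apply: (branch_edge_diff_branch rf fv edge_vw below_v).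
by rewrite eq_br ?inE.
Qed.

(* If all paths through [q] and [y] also pass [z], then [z] is the only vertex
   linked to [y]. *)
Lemma link_deg_gt1 q y z :
  link f Tv q y z -> 1 < #|link f Tv q y| ->
  ~~ (bag Tv q :&: bag Tv y \subset bag Tv z).
Proof.
case/and4P=> _ fz yz _; apply: contraL => /subsetP sub; rewrite -leqNgt.
rewrite -(card1 z); apply/subset_leq_card/subsetP=> t.
case/and4P=> fy ft yt /existsP [v /and3P [qv yv tv]].
have := sub v; rewrite !inE qv yv => /(_ isT) zv.
apply/eqP/(deg2_nbr_eq (@rep_deg v) qv yv tv zv) => //.
Qed.

Lemma bag_adj_nbr q par depth y v w :
  rooted f q par depth -> f q y -> v \in bag Tv q -> w \notin bag Tv q ->
  y \in Tv w -> e v w = (y \in Tv v).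
Proof.
move=> rf fy vq wq yw.
apply/(bag_adj vq wq)/idP=> [[x xv xw]|yv]; last by exists y.
rewrite !inE in vq wq; apply: (subtree_below rf (rep_subtree v) vq xv).
exact: (subtree_below_child rf (rep_subtree w) wq fy yw).
Qed.

Lemma link_branch_edge q y z v w :
  link f Tv q y z -> v \notin bag Tv q -> w \notin bag Tv q ->
  y \in Tv v -> z \in Tv w ->
  ~~ (bag Tv q :&: bag Tv y \subset bag Tv z) ->
  ~~ (bag Tv q :&: bag Tv z \subset bag Tv y) -> branch_edge e (bag Tv q) v w.
Proof.
case/and4P=> fy fz yz /existsP [u /and3P [qu yu zu]] vq wq yv zw nyz nzy.
have [par [depth rf]] := tree_rooted q rep_tree.
have adj_v t : t \in bag Tv q -> e t v = (y \in Tv t).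
  by move=> tq; apply: (bag_adj_nbr rf fy tq vq yv).
have adj_w t : t \in bag Tv q -> e t w = (z \in Tv t).
  by move=> tq; apply: (bag_adj_nbr rf fz tq wq zw).
have disj x : x \in Tv v -> x \notin Tv w.
  move=> xv; apply: contraNN yz => xw; rewrite !inE in vq wq; apply/eqP.
  apply: (below_children_eq rf fy fz (x := x)).
    exact: (subtree_below_child rf (rep_subtree v) vq fy yv).
  exact: (subtree_below_child rf (rep_subtree w) wq fz zw).
have uq : u \in bag Tv q by rewrite inE.
have separated y1 z1 : ~~ (bag Tv q :&: bag Tv y1 \subset bag Tv z1) ->
    exists2 t, t \in bag Tv q & (y1 \in Tv t) && (z1 \notin Tv t).
  case/subsetPn=> t /setIP [tq ty] tz; exists t => //.
  by move: ty tz; rewrite !inE => -> ->.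
split.
- by rewrite inE vq; apply/exists_inP; exists u; rewrite // se.1 adj_v.
- by rewrite inE wq; apply/exists_inP; exists u; rewrite // se.1 adj_w.
- have nvw : v != w by apply: contraNneq (disj y yv) => <-.
  by apply/negP=> /(rep_adjP nvw) [x /disj /negP nxw /nxw].
- by exists u; rewrite // adj_v // adj_w // yu.
split.
  by have [t tq tP] := separated y z nyz; exists t; rewrite // adj_v // adj_w.
by have [t tq tP] := separated z y nzy; exists t; rewrite // adj_v // adj_w.
Qed.

Lemma reduced_locally_colorable h :
  reduced f Tv -> (forall C, is_clique e C -> branch_colorable e C h.+2) ->
  locally_colorable f Tv h.+2.
Proof.
move=> red cliqueP q; have [q0|/set0Pn [u uq]] := eqVneq (bag Tv q) set0.
  exists (fun=> ord0) => y z /and4P [_ _ _ /existsP [v /andP [qv _]]].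
  by have := in_set0 v; rewrite -q0 inE qv.
have [c cP] : branch_colorable e (bag Tv q) h.+2.
  by apply: cliqueP; apply: reduced_bag_clique red _; apply/set0Pn; exists u.
have [y|w wP] := @fin_all_exists U (fun=> T)
    (fun y w => f q y -> bag Tv y != set0 -> y \in Tv w /\ w \notin bag Tv q).
  have [fy|nfy] := boolP (f y q); last first.
    by exists u; rewrite (rep_tree.1.1) (negPf nfy).
  have [_|y0] := eqVneq (bag Tv y) set0; first by exists u.
  by have /subsetPn [w yw wq] := red y q fy y0; exists w; rewrite inE in yw.
have repr y z : link f Tv q y z -> y \in Tv (w y) /\ w y \notin bag Tv q.
  case/and4P=> fy _ _ /existsP [v /and3P [_ yv _]]; apply: wP fy _.
  by apply/set0Pn; exists v; rewrite inE.
apply: (@colorable_deg_gt1 _ _ _ (c \o w)) => [||y z yz degy degz].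
- exact: link_sym.
- exact: link_irr.
have zy : link f Tv q z y by rewrite link_sym.
have [yw wyq] := repr y z yz; have [zw wzq] := repr z y zy.
by apply/cP/(link_branch_edge yz); rewrite ?link_deg_gt1.
Qed.

End Representation.

(** * Contraction *)

Section Contract.
Variables (U : finType) (f : rel U) (q q' : U).
Variables (par : U -> U) (depth : U -> nat).
Hypotheses (rf : rooted f q' par depth) (fq : f q' q).

Definition collapse (x : U) : U := if x == q then q' else x.

(* The contracted vertex [q] is kept as a leaf at [q'], to be removed from all
   subtrees, so that the vertex type of the host tree does not change. *)
Definition contract_par (x : U) : U := collapse (par x).

Definition contract_adj : rel U := parent_adj q' contract_par.

Lemma collapse_id x : x != q -> collapse x = x.
Proof. by rewrite /collapse => /negPf ->. Qed.

Lemma neq_contracted : q' != q.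
Proof. by apply: contraTneq fq => ->; rewrite (rooted_irr rf). Qed.

Lemma collapse_neq x : collapse x != q.
Proof.
by rewrite /collapse; have [_|//] := eqVneq x q; apply: neq_contracted.
Qed.

Lemma contract_rooted : rooted contract_adj q' contract_par depth.
Proof.
split=> // x xq'; rewrite /contract_par /collapse.
have := depth_par rf xq'; case: eqP => // ->; apply: ltn_trans.
have := fq; rewrite (adj_root rf) => /andP [/(depth_par rf) + /eqP parq].
by rewrite parq.
Qed.

Variable S : {set U}.
Hypothesis sS : subtree f S.

Lemma collapse_in x : (q \in S -> q' \in S) -> x \in S -> collapse x \in S :\ q.
Proof.
move=> qS xS; rewrite in_setD1 collapse_neq /collapse.
by case: eqP xS => [-> /qS|].
Qed.

Lemma contract_subtree : (q \in S -> q' \in S) -> subtree contract_adj (S :\ q).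
Proof.
move=> qS; have [t [tS _ par_top]] := subtree_top rf sS.
apply: (subtree_of_top contract_rooted (collapse_in qS tS)) => x.
move=> /setD1P [xq xS] xt; have nxt : x != t.
  by apply: contraNneq xt => <-; rewrite collapse_id.
by have /andP [-> parS] := par_top x xS nxt; apply: collapse_in.
Qed.

Lemma contract_adj_lift x y :
  x \in S :\ q -> y \in S :\ q -> contract_adj x y ->
  exists a b, [/\ a \in S, b \in S, f a b, collapse a = x & collapse b = y].
Proof.
have lift_parent x1 y1 : x1 \in S :\ q -> y1 \in S :\ q ->
    parent_rel q' contract_par x1 y1 ->
    [/\ par x1 \in S, f x1 (par x1), collapse x1 = x1 & collapse (par x1) = y1].
  move=> /setD1P [xq xS] /setD1P [_ yS] /andP [xq' /eqP ypar].
  split=> //; [|exact: (adj_par rf)|exact: collapse_id].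
  have [q'S|nq'S] := boolP (q' \in S); first exact: (subtree_par rf).
  move: yS; rewrite -ypar /contract_par /collapse; case: ifP => // _.
  by rewrite (negPf nq'S).
move=> xS yS /orP [xy|yx].
  have [parS fpar eq_x eq_y] := lift_parent x y xS yS xy.
  by exists x, (par x); case/setD1P: xS.
have [parS fpar eq_y eq_x] := lift_parent y x yS xS yx.
by exists (par y), y; rewrite (rooted_sym rf); case/setD1P: yS.
Qed.

Lemma contract_nbrs_neq x : x \in S :\ q -> x != q' ->
  nbrs contract_adj (S :\ q) x \subset collapse @: nbrs f S x.
Proof.
move=> xS xq'; apply/subsetP=> y /setIdP [yS].
case/(contract_adj_lift xS yS)=> a [b [aS bS fab eq_a <-]].
apply: imset_f; rewrite inE bS; suff -> : x = a by [].
by move: eq_a xq'; rewrite /collapse; case: eqP => // _ ->; rewrite eqxx.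
Qed.

Lemma contract_nbrs_eq : q' \in S -> nbrs contract_adj (S :\ q) q' \subset
  (nbrs f S q' :\ q) :|: [set y in nbrs f S q :\ q' | q \in S].
Proof.
move=> q'S; apply/subsetP=> y /setIdP [yS yq']; have ny : y != q'.
  by apply: contraTneq yq' => ->; rewrite (rooted_irr contract_rooted).
have q'Sq : q' \in S :\ q by rewrite in_setD1 neq_contracted.
have [a [b [aS bS fab eq_a eq_b]]] := contract_adj_lift q'Sq yS yq'.
have eq_by : b = y.
  by move: eq_b ny; rewrite /collapse; case: ifP => // _ ->; rewrite eqxx.
have /setD1P [yq yinS] := yS; rewrite !inE ny yq yinS; rewrite eq_by in fab.
have [eq_aq|naq] := eqVneq a q; first by rewrite -eq_aq aS fab orbT.
by move: eq_a; rewrite collapse_id // => <-; rewrite fab.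
Qed.

Lemma contract_deg : deg_le f S (Some 2) ->
  deg_le contract_adj (S :\ q) (Some 2).
Proof.
move=> degS x xS; have /setD1P [_ xS'] := xS.
have [eq_x|xq'] := eqVneq x q'; last first.
  apply: leq_trans (subset_leq_card (contract_nbrs_neq xS xq')) _.
  exact: leq_trans (leq_imset_card _ _) (degS x xS').
rewrite eq_x in xS' *.
apply: leq_trans (subset_leq_card (contract_nbrs_eq xS')) _.
have deg_q' := degS q' xS'; have [qinS|_] := boolP (q \in S); last first.
  rewrite (_ : [set _ in _ | false] = set0) ?setU0; last first.
    by apply/setP=> y; rewrite !inE andbF.
  exact: leq_trans (subset_leq_card (subsetDl _ _)) deg_q'.
apply: leq_trans (leq_card_setU _ _) _.
rewrite (_ : [set _ in _ | true] = nbrs f S q :\ q'); last first.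
  by apply/setP=> y; rewrite !inE andbT.
move: deg_q' (degS q qinS).
rewrite (cardsD1 q) (cardsD1 q' [set y in S | f q y]) !inE.
rewrite qinS xS' fq (rooted_sym rf) fq !add1n !ltnS => deg_q' deg_q.
exact: (leq_add deg_q' deg_q).
Qed.

End Contract.

Lemma contract_rep (T U : finType) (e : rel T) (f : rel U) (Tv : T -> {set U})
    q q' par depth deg_bound :
  hst_rep e deg_bound (Some 2) 1 f Tv -> rooted f q' par depth -> f q' q ->
  bag Tv q \subset bag Tv q' ->
  hst_rep e None (Some 2) 1 (contract_adj q q' par) (fun v => Tv v :\ q).
Proof.
move=> rep rf fq /subsetP sub; have [_ _ sT degT adj] := rep.
have qq' v : q \in Tv v -> q' \in Tv v by have := sub v; rewrite !inE.
split=> // [|v|v|v w vw].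
- exact: rooted_tree (contract_rooted rf fq).
- exact: (contract_subtree rf fq (sT v) (@qq' v)).
- exact: (contract_deg rf fq (sT v) (degT v)).
apply: (iff_trans (adj v w vw)).
split=> /card_gt0P [x /setIP [xv xw]]; apply/card_gt0P.
  by exists (collapse q q' x); rewrite inE !(collapse_in rf fq) //; apply: qq'.
by exists x; case/setD1P: xv => _ xv; case/setD1P: xw => _ xw; rewrite inE xv.
Qed.

Lemma exists_reduced_rep (T U : finType) (e : rel T) (f : rel U)
    (Tv : T -> {set U}) :
  hst_rep e None (Some 2) 1 f Tv ->
  exists (f' : rel U) Tv', hst_rep e None (Some 2) 1 f' Tv' /\ reduced f' Tv'.
Proof.
have [n] := ubnP #|[set x | bag Tv x != set0]|.
elim: n f Tv => // n IH f Tv lt_n rep.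
have [/existsP [q /existsP [q' /and3P [fqq' q0 sub]]]|nred] := boolP
    [exists q, exists q',
       [&& f q q', bag Tv q != set0 & bag Tv q \subset bag Tv q']]; last first.
  exists f, Tv; split=> // q q' fqq' q0; apply: contra nred => sub.
  by apply/existsP; exists q; apply/existsP; exists q'; rewrite fqq' q0.
have [par [depth rf]] := tree_rooted q' (rep_tree rep).
have fq : f q' q by rewrite (rooted_sym rf).
apply: IH (contract_rep rep rf fq sub); rewrite ltnS in lt_n.
apply: leq_trans lt_n; apply/proper_card/properP; split.
  apply/subsetP=> x; rewrite !inE => /set0Pn [v]; rewrite !inE => /andP [_ xv].
  by apply/set0Pn; exists v; rewrite inE.
exists q; rewrite inE // negbK; apply/eqP/setP=> v.
by rewrite !inE eqxx.
Qed.

(** * Splitting a vertex *)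

Section Split.
Variables (U : finType) (f : rel U) (q : U) (B : {set U}).
Variables (par : U -> U) (depth : U -> nat).
Hypotheses (rf : rooted f q par depth) (fB : {in B, forall a, f q a}).

(* The neighbours of [q] in [B] are detached from [q] and hung from a new
   neighbour [None] of [q]. *)
Definition split_par (x : option U) : option U :=
  if x is Some a then if a \in B then None else Some (par a) else Some q.

Definition split_adj : rel (option U) := parent_adj (Some q) split_par.

Definition split_set (S : {set U}) : {set option U} :=
  [set x | if x is Some a then a \in S else (q \in S) && (B :&: S != set0)].

Lemma split_rooted : rooted split_adj (Some q) split_par
  (fun x => if x is Some a then (depth a).*2 else (depth q).*2.+1).
Proof.
split=> // -[a|] //= aq; case: ifP => [aB|_]; last first.
  by rewrite ltn_double (depth_par rf).
have := fB aB; rewrite (adj_root rf) => /andP [/(depth_par rf) + /eqP para].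
by rewrite para -doubleS leq_double.
Qed.

Lemma split_adj_Some a b : split_adj (Some a) (Some b) =
  [&& f a b, ~~ ((a == q) && (b \in B)) & ~~ ((b == q) && (a \in B))].
Proof.
have parentE x y : parent_rel (Some q) split_par (Some x) (Some y) =
    parent_rel q par x y && ~~ ((y == q) && (x \in B)).
  rewrite /parent_rel (inj_eq Some_inj) /=; case: ifP => xB; last first.
    by rewrite andbF andbT (inj_eq Some_inj).
  have := fB xB; rewrite (adj_root rf) => /andP [_ /eqP ->].
  by rewrite andbT (eq_sym y); case: (q == y); rewrite ?andbF.
have parent_neq x y : parent_rel q par x y -> ~~ ((x == q) && (y \in B)).
  by case/andP=> /negPf ->.
rewrite (rooted_adj rf) {1}/split_adj /parent_adj !parentE.
have [/parent_neq -> /=|_] := boolP (parent_rel q par a b); last first.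
  by have [/parent_neq -> /=|_] := boolP (parent_rel q par b a); rewrite ?andbT.
by have [/parent_neq ->|_] := boolP (parent_rel q par b a); rewrite /= ?orbF.
Qed.

Lemma split_adj_None x :
  split_adj None x = if x is Some a then (a == q) || (a \in B) else false.
Proof.
case: x => [a|]; last exact: (rooted_irr split_rooted).
rewrite /split_adj /parent_adj /parent_rel /= !(inj_eq Some_inj) (eq_sym q).
by have [//|aq] := eqVneq a q; case: ifP.
Qed.

Lemma split_subtree S : subtree f S -> subtree split_adj (split_set S).
Proof.
case/(subtree_top rf)=> t [tS _ par_top].
apply: (subtree_of_top split_rooted (t := Some t)); first by rewrite inE.
move=> [a|]; rewrite inE; last by case/andP=> qS _ _; rewrite inE.
rewrite /= !(inj_eq Some_inj) => aS neq_at.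
have /andP [-> parS] := par_top a aS neq_at; case: ifP => [aB|_].
  have := fB aB; rewrite (adj_root rf) => /andP [_ /eqP para].
  rewrite inE -para parS; apply/set0Pn; exists a.
  by rewrite inE aB.
by rewrite inE.
Qed.

Lemma split_meet (S S' : {set U}) :
  (0 < #|split_set S :&: split_set S'|) = (0 < #|S :&: S'|).
Proof.
apply/card_gt0P/card_gt0P=> [[[a|]]|[a]]; rewrite !inE.
- by move=> aP; exists a; rewrite inE.
- by case/andP=> /andP [qS _] /andP [qS' _]; exists q; rewrite inE qS.
- by move=> aP; exists (Some a); rewrite !inE.
Qed.

Lemma split_setT : B != set0 -> split_set setT = setT.
Proof. by move=> B0; apply/setP=> -[a|]; rewrite !inE // setIT. Qed.

(* Identifying the new vertex with [q] undoes the splitting. *)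
Lemma odflt_split_set S x : x \in split_set S -> odflt q x \in S.
Proof. by case: x => [a|] /=; rewrite inE // => /andP []. Qed.

Lemma odflt_split_adj a x : a != q -> split_adj (Some a) x -> f a (odflt q x).
Proof.
case: x => [b|] aq; first by rewrite split_adj_Some => /and3P [].
rewrite (rooted_sym split_rooted) split_adj_None (negPf aq) => /fB.
by rewrite (rooted_sym rf).
Qed.

Lemma odflt_split_inj a x y :
  a != q -> split_adj (Some a) x -> split_adj (Some a) y ->
  odflt q x = odflt q y -> x = y.
Proof.
move=> aq.
have notboth : ~~ (split_adj (Some a) (Some q) && split_adj (Some a) None).
  rewrite split_adj_Some (rooted_sym split_rooted _ None) split_adj_None.
  by rewrite eqxx (negPf aq); case: (a \in B); rewrite ?andbF.
case: x y => [x|] [y|] //= ax ay eqxy; first by rewrite eqxy.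
  by move: notboth; rewrite -eqxy ax ay.
by move: notboth; rewrite eqxy ax ay.
Qed.

Lemma card_split_nbrs_neq (S : {set U}) a :
  a != q -> #|nbrs split_adj (split_set S) (Some a)| <= #|nbrs f S a|.
Proof.
move=> aq; rewrite -(card_in_imset (f := odflt q)); last first.
  by move=> x y /setIdP [_ ax] /setIdP [_ ay]; apply: odflt_split_inj ax ay.
apply/subset_leq_card/subsetP=> _ /imsetP [x /setIdP [xS ax] ->].
by rewrite inE odflt_split_set ?odflt_split_adj.
Qed.

Lemma card_split_nbrs_root (S : {set U}) : q \in S ->
  #|nbrs split_adj (split_set S) (Some q)| =
  #|nbrs f S q :\: B| + (B :&: S != set0).
Proof.
move=> qS; rewrite (cardsD1 None) addnC !inE qS (rooted_sym split_rooted).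
rewrite split_adj_None eqxx andbT; congr (_ + _).
rewrite -[RHS](card_imset _ (@Some_inj _)); apply: eq_card => -[a|].
  rewrite mem_imset; last exact: Some_inj.
  rewrite !inE split_adj_Some eqxx /=; case: (a \in B); rewrite ?andbF //=.
  have [->|_] := eqVneq a q; rewrite ?andbT //.
  by rewrite (rooted_irr rf) !andbF.
by rewrite !inE eqxx; apply/esym/imsetP=> -[].
Qed.

Lemma split_nbrs_new S :
  nbrs split_adj (split_set S) None = Some @: (S :&: (q |: B)).
Proof.
apply/setP=> -[a|]; rewrite inE split_adj_None; last first.
  by rewrite andbF; apply/esym/imsetP=> -[].
by rewrite mem_imset ?inE //; apply: Some_inj.
Qed.

Lemma card_split_nbrs_new S :
  #|nbrs split_adj (split_set S) None| <= (#|B :&: S|).+1.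
Proof.
rewrite split_nbrs_new card_imset; last exact: Some_inj.
rewrite setIUr -add1n; apply: leq_trans (leq_card_setU _ _) _.
rewrite setIC (setIC S); apply: leq_add => //.
by rewrite -(cards1 q) subset_leq_card ?subsetIl.
Qed.

Lemma split_deg (S : {set U}) k :
  deg_le f S (Some k) -> (q \in S -> #|B :&: S| < k) ->
  deg_le split_adj (split_set S) (Some k).
Proof.
move=> degS ltB [a|]; rewrite inE; last first.
  by case/andP=> qS _; apply: leq_trans (card_split_nbrs_new S) (ltB qS).
move=> aS; have [eq_a|aq] := eqVneq a q; last first.
  exact: leq_trans (card_split_nbrs_neq S aq) (degS a aS).
rewrite eq_a in aS *; apply: leq_trans (degS q aS).
rewrite (card_split_nbrs_root aS) -(cardsID B [set y in S | f q y]).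
rewrite addnC leq_add2r.
have [//|/set0Pn [b /setIP [bB bS]]] := eqVneq (B :&: S) set0.
by rewrite card_gt0; apply/set0Pn; exists b; rewrite !inE bS bB fB.
Qed.

Section SplitLinks.
Variables (T : finType) (Tv : T -> {set U}) (h : nat).
Local Notation split_Tv := (fun v => split_set (Tv v)).

Lemma split_link_neq a x y : a != q ->
  link split_adj split_Tv (Some a) x y -> link f Tv a (odflt q x) (odflt q y).
Proof.
move=> aq /and4P [ax ay xy /existsP [v /and3P [av xv yv]]].
rewrite /link !odflt_split_adj //=; apply/andP; split.
  by apply: contraNneq xy => /(odflt_split_inj aq ax ay) ->.
rewrite inE in av; apply/existsP; exists v.
by rewrite av !odflt_split_set.
Qed.

Lemma split_link_root_colorable (col : U -> 'I_h) k :
  (forall y z, link f Tv q y z -> col y != col z) ->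
  {in B, forall a, col a = k} -> colorable (link split_adj split_Tv (Some q)) h.
Proof.
move=> colP colB; exists (fun x => if x is Some a then col a else k).
have adj_q a : split_adj (Some q) (Some a) -> f q a && (a \notin B).
  by rewrite split_adj_Some eqxx => /and3P [-> ->].
have new_col z : link split_adj split_Tv (Some q) None (Some z) -> k != col z.
  case/and4P=> _ /adj_q /andP [fz zB] _ /existsP [v /and3P []]; rewrite !inE.
  move=> qv /andP [_ /set0Pn [a /setIP [aB av]]] zv; rewrite -(colB a aB).
  apply: colP; rewrite /link fB // fz /=; apply/andP; split.
    by apply: contraNneq zB => <-.
  by apply/existsP; exists v; rewrite qv av.
move=> [y|] [z|]; [|by rewrite link_sym eq_sym => /new_col | exact: new_col|].
  case/and4P=> /adj_q /andP [fy _] /adj_q /andP [fz _] yz /existsP [v].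
  rewrite !inE => v_qyz; apply: colP; rewrite /link fy fz yz.
  by apply/existsP; exists v.
by rewrite link_irr.
Qed.

End SplitLinks.

Lemma split_locally_colorable (T : finType) (Tv : T -> {set U}) h
    (col : U -> 'I_h.+1) k :
  #|B| < h.+1 -> (forall y z, link f Tv q y z -> col y != col z) ->
  {in B, forall a, col a = k} -> locally_colorable f Tv h.+1 ->
  locally_colorable split_adj (fun v => split_set (Tv v)) h.+1.
Proof.
move=> ltB colP colB lc [a|].
  have [->|aq] := eqVneq a q; first exact: split_link_root_colorable colP colB.
  by apply: (colorable_hom (g := odflt q)) (lc a) => x y; apply: split_link_neq.
have deg_new := card_split_nbrs_new setT; rewrite setIT in deg_new.
have [c c_inj] := exists_inj_ord (leq_trans deg_new ltB).
have new_nbr x : split_adj None x -> x \in nbrs split_adj (split_set setT) None.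
  by case: x => [b|]; rewrite ?split_adj_None // !inE split_adj_None.
exists c => x y /and4P [/new_nbr xN /new_nbr yN xy _].
by apply: contraNneq xy => /c_inj ->.
Qed.

Lemma split_rep (T : finType) (e : rel T) (Tv : T -> {set U}) deg_bound k :
  hst_rep e deg_bound (Some k) 1 f Tv ->
  (forall v, q \in Tv v -> #|B :&: Tv v| < k) ->
  hst_rep e None (Some k) 1 split_adj (fun v => split_set (Tv v)).
Proof.
case=> _ _ sT degT adj ltB; split=> // [|v|v|v w vw].
- exact: rooted_tree split_rooted.
- exact: split_subtree.
- exact: split_deg (degT v) (ltB v).
by rewrite split_meet; apply: adj.
Qed.

End Split.

Definition excess (U : finType) (f : rel U) (h : nat) : nat :=
  \sum_(x : U) (#|nbrs f setT x| - h).

Lemma big_option (R : Type) (idx : R) (op : SemiGroup.com_law R) (U : finType)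
    (F : option U -> R) :
  \big[op/idx]_x F x = op (F None) (\big[op/idx]_(a : U) F (Some a)).
Proof.
have enum_option : enum {: option U} = None :: map Some (enum U).
  by rewrite !enumT [in LHS]unlock.
by rewrite -big_enum enum_option big_cons big_map big_enum.
Qed.

Lemma split_excess (U : finType) (f : rel U) q par depth (B : {set U}) h :
  rooted f q par depth -> {in B, forall a, f q a} ->
  1 < #|B| -> #|B| < h -> h < #|nbrs f setT q| ->
  excess (split_adj q B par) h < excess f h.
Proof.
move=> rf fB gtB ltB degq; rewrite /excess big_option /=.
have B0 : B != set0 by rewrite -card_gt0 ltnW.
have <- := split_setT q B0.
have -> : #|nbrs (split_adj q B par) (split_set q B setT) None| - h = 0.
  apply/eqP; rewrite subn_eq0.
  by apply: leq_trans (card_split_nbrs_new rf fB setT) _; rewrite setIT.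
rewrite add0n (bigD1 q) //= [X in _ < X](bigD1 q) //= -addSn.
apply: leq_add; last first.
  by apply: leq_sum => a aq; apply/leq_sub2r/(card_split_nbrs_neq rf fB).
apply: ltn_sub2r degq _; rewrite (card_split_nbrs_root rf fB) ?inE // setIT B0.
have sub_B : B \subset nbrs f setT q by apply/subsetP=> a aB; rewrite !inE fB.
by rewrite -(cardsID B (nbrs f setT q)) (setIidPr sub_B) addnC ltn_add2r.
Qed.

Lemma locally_colorable_bounded_rep (T : finType) (e : rel T) h (U : finType)
    (f : rel U) (Tv : T -> {set U}) :
  hst_rep e None (Some 2) 1 f Tv -> locally_colorable f Tv h.+3 ->
  in_hst e (Some h.+3) (Some 2) 1.
Proof.
have [n] := ubnP (excess f h.+3).
elim: n U f Tv => // n IH U f Tv; rewrite ltnS => lt_n rep lc.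
have [/existsP [q degq]|small] :=
    boolP [exists q, h.+3 < #|nbrs f setT q|]; last first.
  case: rep => treef _ sT degT adj; exists U, f, Tv; split=> // x _.
  by rewrite leqNgt; apply: contra small => degx; apply/existsP; exists x.
have [col colP] := lc q; have [par [depth rf]] := tree_rooted q (rep_tree rep).
have : ~~ dinjectiveb col (mem (nbrs f setT q)).
  by apply: contraL degq => /dinjectiveP /leq_card_in; rewrite card_ord -leqNgt.
case/dinjectivePn=> i /setIdP [_ fi] [j /andP [nji /setIdP [_ fj]] col_ij].
pose B := [set i; j].
have fB : {in B, forall a, f q a} by move=> a /set2P [] ->.
have colB : {in B, forall a, col a = col i} by move=> a /set2P [] ->.
have cardB : #|B| = 2 by rewrite cards2 eq_sym nji.
apply: (IH _ (split_adj q B par) (fun v => split_set q B (Tv v))).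
- by apply: leq_trans lt_n; apply: (split_excess rf fB); rewrite ?cardB.
- apply: (split_rep rf fB rep) => v qv; rewrite ltnS; apply/card_le1_eqP=> a b.
  move=> /setIP [aB av] /setIP [bB bv]; apply/eqP/negPn/negP=> ba.
  have : link f Tv q a b.
    by rewrite /link !fB // eq_sym ba; apply/existsP; exists v; rewrite qv av.
  by move/colP; rewrite !colB ?eqxx.
by apply: (split_locally_colorable rf fB _ colP colB); rewrite ?cardB.
Qed.

Lemma clique_neq0 (T : finType) (e : rel T) C (x : T) :
  is_clique e C -> C != set0.
Proof.
by move=> [_ maxC]; apply/eqP=> C0; have [|y] := maxC x; rewrite C0 inE.
Qed.

Lemma bounded_rep_branch_colorable (T : finType) (e : rel T) h C :
  simple_graph e -> in_hst e (Some h.+1) (Some 2) 1 ->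
  C != set0 -> is_clique e C -> branch_colorable e C h.+1.
Proof.
move=> se [U [f [Tv rep]]] C0 /(clique_bag rep C0) [q ->].
by apply: (bag_branch_colorable se rep); case: rep => _ degf _ _ _; apply: degf.
Qed.

Theorem mainTheorem4 (T : finType) (e : rel T) :
  simple_graph e -> connected_graph e -> VPT e ->
  (forall h : nat, 3 <= h ->
     (in_hst e (Some h) (Some 2) 1 <->
      (forall C : {set T}, is_clique e C -> branch_colorable e C h))) /\
  (in_hst e (Some 2) (Some 2) 1 ->
      (forall C : {set T}, is_clique e C -> branch_colorable e C 2)).
Proof.
move=> se [/card_gt0P [x _] _] [U [f [Tv rep]]].
have forward h : in_hst e (Some h.+1) (Some 2) 1 ->
    forall C, is_clique e C -> branch_colorable e C h.+1.
  move=> in_h C cliqueC.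
  exact: bounded_rep_branch_colorable se in_h (clique_neq0 x cliqueC) cliqueC.
split; last exact: forward.
case=> [|[|[|h]]] // _; split=> [|cliqueP]; first exact: forward.
have [f' [Tv' [rep' red]]] := exists_reduced_rep rep.
apply: (locally_colorable_bounded_rep rep').
exact: (reduced_locally_colorable se rep' red cliqueP).
Qed.
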